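(* Fix a time period $t$. The solution to the single-period dispatch subproblem at time $t$ (defined in the context) with a given water price $\theta$ is as follows if $\lambda_t \ge 0$: $$s_t^* = \min\{\alpha_t S,\ P\},$$ $$u_t^* = \max\bigl\{u_{t-1} - \underline{R},\ \underline{u},\ \min\{\overline{u},\ u_{t-1} + \overline{R},\ \hat{u}_t\}\bigr\},$$ $$V_t^* = V_{t-1} + I_t - u_t^*,$$ $$h_t^* = \min\Bigl\{P - s_t^*,\ \frac{\eta g \rho\, \phi(V_t^* )\, u_t^*}{3.6\times 10^9}\Bigr\},$$ where $$\hat{u}_t = \begin{cases} \dfrac{(P - s_t^* )\cdot 3.6\times 10^9}{\eta g \rho\, \phi(V_{t-1})} & \text{if } \hat{\theta} > \theta,\\[2mm] 0 & \text{otherwise,}\end{cases} \qquad \hat{\theta} = \frac{\lambda_t\, \eta g \rho\, \phi(V_{t-1})}{3.6\times 10^9}.$$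
   Context: A coupled hydropower and floating solar system is dispatched hour by hour. Data: electricity price $\lambda_t$; reservoir inflow $I_t$; solar capacity factor $\alpha_t$; installed solar capacity $S$; transmission capacity $P$; hydropower efficiency $\eta$, gravitational constant $g$, water density $\rho$; lower and upper water release bounds $\underline{u}$, $\overline{u}$; downward and upward ramp limits $\underline{R}$, $\overline{R}$ on the release; and a (possibly nonlinear) hydraulic head function $\phi$, giving the head as a function of reservoir volume. The factor $3.6\times 10^9$ converts joules to MWh. The number $\theta$ is the price charged per unit of released water (the multiplier of a relaxed long-term total-release constraint). Single-period dispatch subproblem at time $t$ with water price $\theta$: with the previous release $u_{t-1}$ and previous volume $V_{t-1}$ treated as fixed parameters, choose $(h_t, s_t, u_t, V_t)$ to $$\max\ \lambda_t (h_t + s_t) - \theta u_t$$ subject to $$V_t - V_{t-1} = I_t - u_t,$$ $$0 \le h_t \le \eta g \rho\, \phi(V_{t-1})\, u_t / (3.6\times 10^9),$$ $$\underline{u} \le u_t \le \overline{u},$$ $$-\underline{R} \le u_t - u_{t-1} \le \overline{R},$$ $$0 \le s_t \le \alpha_t S,$$ $$0 \le s_t + h_t \le P.$$ Here $h_t$ is the dispatched hydropower energy, $s_t$ the dispatched solar energy, $u_t$ the water release, and $V_t$ the reservoir volume.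
   Formalization: In h_t^* the head is φ(V_{t-1}) instead of the printed φ(V_t^* ), which can make the point infeasible or suboptimal; θ ≥ 0 is assumed (the claim fails for θ < 0), as are η, g, ρ, φ(V_{t-1}) > 0 and feasibility of the subproblem. *)

(* Defs.v *)
(* MathComp. *)
From HB Require Import structures.
From mathcomp Require Import all_boot all_order all_algebra.
Set Implicit Arguments.
Unset Strict Implicit.
Unset Printing Implicit Defensive.
Import Order.TTheory GRing.Theory Num.Theory.
Local Open Scope ring_scope.

Record system (R : realFieldType) := System {
  price : nat -> R;           (* lambda_t *)
  inflow : nat -> R;          (* I_t *)
  solar_factor : nat -> R;    (* alpha_t *)
  solar_capacity : R;         (* S *)
  transmission : R;           (* P *)
  efficiency : R;             (* eta *)
  gravity : R;                (* g *)
  density : R;                (* rho *)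
  release_min : R;
  release_max : R;
  ramp_down : R;              (* bound on the decrease of the release *)
  ramp_up : R;                (* bound on its increase *)
  hydraulic_head : R -> R     (* phi, as a function of reservoir volume *)
}.

Record dispatch (R : realFieldType) := Dispatch {
  hydro : R;                  (* h_t *)
  solar : R;                  (* s_t *)
  release : R;                (* u_t *)
  volume : R                  (* V_t *)
}.

(* 3.6 * 10^9, kept factored so that no large unary numeral is ever built. *)
Definition joules_per_MWh (R : realFieldType) : R := 36 / 10 * 10 ^+ 9.

(* In what follows u0 and V0 stand for u_{t-1} and V_{t-1}. *)

Record feasible (R : realFieldType) (D : system R) (t : nat) (u0 V0 : R)
    (x : dispatch R) : Prop := Feasible {
  water_balance : volume x - V0 = inflow D t - release x;
  hydro_bounds :
    0 <= hydro x <= efficiency D * gravity D * density D * hydraulic_head D V0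
                    * release x / joules_per_MWh R;
  release_bounds : release_min D <= release x <= release_max D;
  ramp_bounds : - ramp_down D <= release x - u0 <= ramp_up D;
  solar_bounds : 0 <= solar x <= solar_factor D t * solar_capacity D;
  transmission_bounds : 0 <= solar x + hydro x <= transmission D
}.

Definition profit (R : realFieldType) (D : system R) (t : nat) (theta : R)
    (x : dispatch R) : R :=
  price D t * (hydro x + solar x) - theta * release x.

Definition optimal_dispatch (R : realFieldType) (D : system R) (t : nat)
    (u0 V0 theta : R) (x : dispatch R) : Prop :=
  feasible D t u0 V0 x /\
  forall y : dispatch R, feasible D t u0 V0 y ->
    profit D t theta y <= profit D t theta x.

Definition solar_star (R : realFieldType) (D : system R) (t : nat) : R :=
  Num.min (solar_factor D t * solar_capacity D) (transmission D).

Definition theta_hat (R : realFieldType) (D : system R) (t : nat) (V0 : R) : R :=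
  price D t * (efficiency D * gravity D * density D * hydraulic_head D V0)
  / joules_per_MWh R.

Definition u_hat (R : realFieldType) (D : system R) (t : nat)
    (V0 theta : R) : R :=
  if theta < theta_hat D t V0 then
    (transmission D - solar_star D t) * joules_per_MWh R
    / (efficiency D * gravity D * density D * hydraulic_head D V0)
  else 0.

Definition release_star (R : realFieldType) (D : system R) (t : nat)
    (u0 V0 theta : R) : R :=
  Num.max (u0 - ramp_down D)
    (Num.max (release_min D)
       (Num.min (release_max D)
          (Num.min (u0 + ramp_up D) (u_hat D t V0 theta)))).

Definition volume_star (R : realFieldType) (D : system R) (t : nat)
    (u0 V0 theta : R) : R :=
  V0 + inflow D t - release_star D t u0 V0 theta.

(* The head is taken at V0, as in [hydro_bounds]. Taking it at the final volume
   [volume_star] instead would break [hydro_bounds] whenever the head rises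
   during the period and transmission is slack, and would leave generation
   unused when the head falls. *)
Definition hydro_star (R : realFieldType) (D : system R) (t : nat)
    (u0 V0 theta : R) : R :=
  Num.min (transmission D - solar_star D t)
    (efficiency D * gravity D * density D * hydraulic_head D V0
     * release_star D t u0 V0 theta / joules_per_MWh R).

(* Main.v *)
(* With solar dispatched first and q the transmission capacity it leaves, a release u
   earns at most lambda (min q (k u)) - theta u on top of the solar income, where k is
   the energy produced per unit of water. This bound is concave and piecewise linear
   in u with its only kink at u = q / k: it increases before the kink exactly when
   theta < lambda k, and never increases after it. Hence the best release is the
   projection onto the admissible interval of the kink, or of 0. *)
Require Import Defs.
From HB Require Import structures.
From mathcomp Require Import all_boot all_order all_algebra.
From mathcomp Require Import ring lra.
Set Implicit Arguments.
Unset Strict Implicit.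
Unset Printing Implicit Defensive.
Import Order.TTheory GRing.Theory Num.Theory.
Local Open Scope ring_scope.

Lemma joules_per_MWh_gt0 (R : realFieldType) : 0 < joules_per_MWh R.
Proof. by rewrite /joules_per_MWh mulr_gt0 ?divr_gt0 ?exprn_gt0 ?ltr0n. Qed.

Lemma le_min_linear_profit (R : realFieldType) (lambda theta k q a b u v : R) :
    0 < k -> 0 <= lambda -> 0 <= theta -> 0 <= u -> a <= u <= b ->
    v = Num.max a (Num.min b (if theta < lambda * k then q / k else 0)) ->
  lambda * Num.min q (k * u) - theta * u
    <= lambda * Num.min q (k * v) - theta * v.
Proof.
move=> k_gt0 lambda_ge0 theta_ge0 u_ge0 /andP[au ub] v_def.
(* Capping at [q] can only flatten the line of slope [k], so extra release adds energy at rate at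
   most [k]. *)
have lip (x y : R) : x <= y ->
    Num.min q (k * y) - Num.min q (k * x) <= k * (y - x).
  move=> xy; have : k * x <= k * y by rewrite ler_pM2l.
  by case: (leP q (k * x)); case: (leP q (k * y)) => *; lra.
have [theta_lt|theta_ge] := ltP theta (lambda * k); last first.
  (* Here [v] projects 0, and [u] is nonnegative and at least [a]. Cutting the release from [u] to
     [v] loses revenue at rate at most [lambda * k], which the saving [theta] covers. *)
  have vu : v <= u.
    by rewrite v_def ltNge theta_ge /= ge_max au ge_min u_ge0 orbT.
  have := ler_wpM2l lambda_ge0 (lip _ _ vu).
  have : 0 <= (theta - lambda * k) * (u - v) by rewrite mulr_ge0 ?subr_ge0.
  lra.
have vE : v = Num.max a (Num.min b (q / k)) by rewrite v_def theta_lt.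
have [vu|uv] := leP v u.
  (* Either [v] already saturates [q] and the surplus [u - v] only costs water, or the cap [b] holds
     [v] below the kink, which forces [u = v]. *)
  have [qv|vq] := leP (q / k) v.
    have qkv : q <= k * v by rewrite mulrC -ler_pdivrMr.
    have -> : Num.min q (k * v) = q by apply/min_idPl.
    apply: lerB; last exact: ler_wpM2l.
    by apply: ler_wpM2l => //; rewrite ge_min lexx.
  have bv : b <= v.
    have : Num.min b (q / k) <= v by rewrite vE le_max lexx orbT.
    by rewrite ge_min (leNgt (q / k)) vq orbF.
  by have -> : v = u by apply/le_anti; rewrite vu (le_trans ub bv).
(* Since [a <= u < v], the lower clip is inactive: [v] lies on the rising piece, where each unit
   gains [lambda * k - theta]. *)
have vq : v <= q / k.
  have : v <= Num.max a (Num.min b (q / k)) by rewrite vE.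
  by rewrite le_max (leNgt v a) (le_lt_trans au uv) /= le_min => /andP[].
have -> : Num.min q (k * v) = k * v.
  by apply/min_idPr; rewrite mulrC -ler_pdivlMr.
have : lambda * Num.min q (k * u) <= lambda * (k * u).
  by apply: ler_wpM2l => //; rewrite ge_min lexx orbT.
have : 0 <= (lambda * k - theta) * (v - u).
  by rewrite mulr_ge0 // subr_ge0 ltW.
lra.
Qed.

Theorem proposition3 (R : realFieldType) (D : system R) (t : nat)
    (u0 V0 theta : R)
    (eta_gt0 : 0 < efficiency D) (g_gt0 : 0 < gravity D)
    (rho_gt0 : 0 < density D) (head_gt0 : 0 < hydraulic_head D V0)
    (theta_ge0 : 0 <= theta)
    (feas : exists x : dispatch R, feasible D t u0 V0 x)
    (price_ge0 : 0 <= price D t) :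
  optimal_dispatch D t u0 V0 theta
    {| hydro := hydro_star D t u0 V0 theta;
       solar := solar_star D t;
       release := release_star D t u0 V0 theta;
       volume := volume_star D t u0 V0 theta |}.
Proof.
have J_gt0 := joules_per_MWh_gt0 R.
set c := efficiency D * gravity D * density D * hydraulic_head D V0.
have c_gt0 : 0 < c by rewrite /c !mulr_gt0.
pose k := c / joules_per_MWh R.
have k_gt0 : 0 < k by rewrite divr_gt0.
have kE u : c * u / joules_per_MWh R = k * u by rewrite /k mulrAC.
pose a := Num.max (u0 - ramp_down D) (release_min D).
pose b := Num.min (release_max D) (u0 + ramp_up D).
pose q := transmission D - solar_star D t.
pose v := release_star D t u0 V0 theta.
have vE : v = Num.max a (Num.min b (if theta < price D t * k then q / k else 0)).
  rewrite /v /release_star /u_hat /theta_hat -/c -/q -mulrA -/k.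
  have -> : q * joules_per_MWh R / c = q / k by rewrite -mulrA /k invf_div.
  by rewrite /a /b maxA minA.
have hE : hydro_star D t u0 V0 theta = Num.min q (k * v).
  by rewrite /hydro_star -/c -/v kE.
(* [release_min D] may be negative; the sign of the release comes from [hydro_bounds], as [k] is
   positive. *)
have range y : feasible D t u0 V0 y -> 0 <= release y /\ a <= release y <= b.
  case=> _ /andP[h0 hle] /andP[r1 r2] /andP[r3 r4] _ _; split.
    by rewrite -(pmulr_rge0 _ k_gt0) -kE (le_trans h0 hle).
  rewrite /a /b ge_max le_min r1 r2 andbT /=.
  by apply/andP; split; lra.
case: feas => x fx.
have [x_ge0 /andP[ax xb]] := range _ fx.
have [sx_ge0 P_ge0] :
    0 <= solar_factor D t * solar_capacity D /\ 0 <= transmission D.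
  case: fx => _ _ _ _ /andP[s1 s2] /andP[s3 s4].
  by split; [apply: le_trans s1 s2 | apply: le_trans s3 s4].
have s_ge0 : 0 <= solar_star D t by rewrite le_min sx_ge0.
have q_ge0 : 0 <= q by rewrite subr_ge0 ge_min lexx orbT.
(* The feasible [x] gives [0 <= b], and both targets [q / k] and 0 are nonnegative, so the inner
   minimum is too. *)
have v_ge0 : 0 <= v.
  rewrite vE le_max le_min (le_trans x_ge0 xb) /=.
  by apply/orP; right; case: ifP => // _; rewrite divr_ge0 // ltW.
have av : a <= v by rewrite vE le_max lexx.
have vb : v <= b by rewrite vE ge_max (le_trans ax xb) ge_min lexx.
split.
  split; rewrite /= ?hE -/v.
  - by rewrite /volume_star -/v; ring.
  - by rewrite -/c kE le_min q_ge0 mulr_ge0 ?ge_min ?lexx ?orbT // ltW.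
  - move: av vb; rewrite /a /b ge_max le_min.
    by move=> /andP[_ ->] /andP[-> _].
  - move: av vb; rewrite /a /b ge_max le_min => /andP[? _] /andP[_ ?].
    by apply/andP; split; lra.
  - by rewrite s_ge0 ge_min lexx.
  - have h_ge0 : 0 <= Num.min q (k * v) by rewrite le_min q_ge0 mulr_ge0 // ltW.
    by rewrite addr_ge0 //= addrC -lerBrDr ge_min lexx.
move=> y fy; have [y_ge0 y_range] := range _ fy.
have := le_min_linear_profit k_gt0 price_ge0 theta_ge0 y_ge0 y_range vE.
rewrite /profit /= hE -/v => le_y.
have energy_le : hydro y + solar y <= solar_star D t + Num.min q (k * release y).
  case: fy => _; rewrite -/c kE.
  move=> /andP[h1 h2] _ _ /andP[s1 s2] /andP[p1 p2].
  have qE : q = transmission D - solar_star D t by [].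
  have : hydro y + solar y - solar_star D t <= k * release y.
    have ky_ge0 : 0 <= k * release y := le_trans h1 h2.
    (* If solar availability is the smaller term, it bounds [solar y]; otherwise solar alone fills
       the line, and the total is at most [transmission D]. *)
    by rewrite /solar_star; case: (leP (_ * _) (transmission D)) => _; lra.
  by rewrite -lerBlDl le_min => ->; rewrite andbT; lra.
have := ler_wpM2l price_ge0 energy_le.
lra.
Qed.
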